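(* Let $(X,G,W)$ be a convex $G$-metric space with a convex structure $W$, and let $T:X\to X$ be a mapping with a fixed point $u$ satisfying $$G(Tx,Ty,Tz)\le a\,G(x,Tx,Tx)+b\,G(y,Ty,Ty)+c\,G(z,Tz,Tz)$$ for all $x,y,z\in X$, where $a,b,c$ are nonnegative real numbers with $0\le a+b+c<1$ and $a<\frac12$. Let $x_0\in X$, let $\{\alpha_n\}_{n\ge 0}\subset[0,1]$ satisfy $\sum_{n=0}^{\infty}\alpha_n=\infty$, and let $\{x_n\}$ be the Mann iterative process defined by $$x_{n+1}=W(x_n,Tx_n;1-\alpha_n,\alpha_n),\qquad n=0,1,2,\dots.$$ Then $\{x_n\}$ converges strongly to a fixed point of $T$.
   Context: A $G$-metric space is a pair $(X,G)$ where $X$ is a nonempty set and $G:X\times X\times X\to[0,\infty)$ satisfies: (i) $G(x,y,z)=0$ if $x=y=z$; (ii) $0<G(x,x,y)$ for all $x,y\in X$ with $x\ne y$; (iii) $G(x,x,y)\le G(x,y,z)$ for all $x,y,z\in X$ with $z\ne y$; (iv) $G$ is symmetric in all three variables; (v) $G(x,y,z)\le G(x,a,a)+G(a,y,z)$ for all $x,y,z,a\in X$. A convex structure on a $G$-metric space $(X,G)$ is a mapping $W:X^2\times I^2\to X$, with $I=[0,1]$, such that $G(W(x,y;\lambda,\beta),u,v)\le\lambda G(x,u,v)+\beta G(y,u,v)$ for all $x,y,u,v\in X$ and all $\lambda,\beta\in I$ with $\lambda+\beta=1$. The triple $(X,G,W)$ is then called a convex $G$-metric space. A sequence $\{x_n\}$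 in $X$ converges (strongly, i.e. $G$-converges) to $x\in X$ if $\lim_{n,m\to\infty}G(x,x_n,x_m)=0$; equivalently, $G(x_n,x,x)\to0$ as $n\to\infty$. *)

(* Defs.v *)
From mathcomp Require Import all_boot all_order all_algebra.
From mathcomp Require Import all_classical all_reals all_analysis.

Set Implicit Arguments.
Unset Strict Implicit.
Unset Printing Implicit Defensive.

Import Order.TTheory GRing.Theory Num.Theory.
Import numFieldNormedType.Exports.

Local Open Scope classical_set_scope.
Local Open Scope ring_scope.

Record is_Gmetric (R : realType) (X : Type) (G : X -> X -> X -> R) : Prop := {
  Gmetric_inhabited : inhabited X ;
  Gmetric_ge0 : forall x y z, 0 <= G x y z ;
  Gmetric_eq0 : forall x y z, x = y -> y = z -> G x y z = 0 ;
  Gmetric_gt0 : forall x y, x <> y -> 0 < G x x y ;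
  Gmetric_le : forall x y z, z <> y -> G x x y <= G x y z ;
  Gmetric_sym : forall x y z,
    [/\ G x y z = G x z y, G x y z = G y x z, G x y z = G y z x,
        G x y z = G z x y & G x y z = G z y x] ;
  Gmetric_rectangle : forall x y z a, G x y z <= G x a a + G a y z
}.

(* {i01 R} is the unit interval I = [0, 1] as a type. *)
Definition is_convex_structure (R : realType) (X : Type)
    (G : X -> X -> X -> R) (W : X -> X -> {i01 R} -> {i01 R} -> X) : Prop :=
  forall (x y u v : X) (l b : {i01 R}), l%:num + b%:num = 1 ->
    G (W x y l b) u v <= l%:num * G x u v + b%:num * G y u v.

Definition is_convex_Gmetric (R : realType) (X : Type)
    (G : X -> X -> X -> R) (W : X -> X -> {i01 R} -> {i01 R} -> X) : Prop :=
  is_Gmetric G /\ is_convex_structure G W.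

(* The limit is a double limit: the filter (\oo, \oo) on nat * nat lets both
   indices go to infinity independently. *)
Definition Gcvg (R : realType) (X : Type) (G : X -> X -> X -> R)
    (x_ : nat -> X) (x : X) : Prop :=
  G x (x_ nm.1) (x_ nm.2) @[nm --> (\oo, \oo)] --> (0 : R).

Definition is_Mann_iteration (R : realType) (X : Type)
    (W : X -> X -> {i01 R} -> {i01 R} -> X) (T : X -> X)
    (alpha : nat -> {i01 R}) (x_ : nat -> X) : Prop :=
  forall n : nat, x_ n.+1 =
    W (x_ n) (T (x_ n)) (1 - (alpha n)%:num)%:i01 (alpha n).

(* Main.v *)
Require Import Defs.
From mathcomp Require Import all_boot all_order all_algebra.
From mathcomp Require Import all_classical all_reals all_analysis.
From mathcomp Require Import lra.
Import Order.TTheory GRing.Theory Num.Theory.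
Import numFieldNormedType.Exports.

Local Open Scope classical_set_scope.
Local Open Scope ring_scope.

(** Why the theorem holds: every fixed point [u] of [T] attracts its orbit of
    Mann iterates.  Put [D = G x (T x) (T x)].  Since [u] contributes nothing
    to the right-hand side of the contraction, comparing [T x] with [u] twice
    gives [G (T x) u u <= a D], comparing [u] with [T x] twice gives
    [G u (T x) (T x) <= (b + c) D], and the rectangle inequality closes the
    loop: [D <= G x u u + (b + c) D].  Hence [T] contracts the distance to [u]
    by the factor [k = a / (1 - (b + c)) < 1] ([Gmetric_contract_fixpoint]).

    Convexity turns this into the scalar recursion
    [g (n+1) <= (1 - (1 - k) alpha_n) g n] for [g n = G (x_ n) u u].
    The usual conclusion goes through the infinite product; here it is replaced
    by telescoping: the decrements [(1 - k) alpha_n g n] sum to at most [g 0],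
    so a divergent series of steps forbids [g] to stay above any positive
    number, and [g] is nonincreasing ([Mann_decay_cvg0]).  Finally
    [G u (x_ n) (x_ m) <= g n + g m] gives the double limit. *)

(** Turns an infinite extended-real sum into the only form of divergence that
    the telescoping argument needs: large finite partial sums. *)
Lemma nneseries_pinfty_gt (R : realType) (f : nat -> R) (M : R) :
  (forall n, 0 <= f n) -> (\sum_(0 <= n <oo) (f n)%:E = +oo)%E ->
  exists n, M < \sum_(0 <= i < n) f i.
Proof.
move=> f0 foo; apply/not_existsP => Mf.
suff : (\sum_(0 <= n <oo) (f n)%:E <= M%:E)%E by rewrite foo.
apply: lime_le; first by apply: is_cvg_nneseries => n _ _; rewrite lee_fin.
apply: nearW => n; rewrite sumEFin lee_fin leNgt.
exact/negP/Mf.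
Qed.

(** The decrements of [g] telescope, so [d * e * sum alpha <= g 0] as long as
    [g] stays above [e]; a divergent sum therefore forces [g] below [e]. *)
Lemma Mann_decay_cvg0 (R : realType) (g alpha : nat -> R) (d : R) :
  0 < d -> (forall n, 0 <= alpha n) -> (forall n, 0 <= g n) ->
  (\sum_(0 <= n <oo) (alpha n)%:E = +oo)%E ->
  (forall n, g n.+1 <= (1 - d * alpha n) * g n) ->
  g n @[n --> \oo] --> (0 : R).
Proof.
move=> d0 alpha0 g0 alphaoo g_rec.
have g_dec n : g n.+1 <= g n.
  have := g_rec n; have := mulr_ge0 (mulr_ge0 (ltW d0) (alpha0 n)) (g0 n).
  lra.
have g_homo : {homo g : n m / (n <= m)%N >-> m <= n}.
  exact/nonincreasing_seqP.
apply/cvgrPdist_lt => e e0.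
have [N gN] : exists N, g N < e.
  apply/not_existsP => g_ge.
  have {}g_ge n : e <= g n by rewrite leNgt; apply/negP/g_ge.
  (* Past this threshold the total decrement would exceed the initial value. *)
  have [n] := nneseries_pinfty_gt _ _ (g 0%N / (d * e)) alpha0 alphaoo.
  rewrite ltr_pdivrMr ?mulr_gt0// ltNge => /negP; apply.
  suff : \sum_(0 <= i < n) alpha i * (d * e) <= g 0%N - g n.
    by rewrite -mulr_suml; have := g0 n; lra.
  elim: n => [|n IHn]; first by rewrite big_geq// subrr.
  rewrite big_nat_recr//=.
  have := g_rec n.
  have := ler_wpM2l (mulr_ge0 (ltW d0) (alpha0 n)) (g_ge n).
  lra.
exists N => // n /= Nn.
by rewrite sub0r normrN ger0_norm// (le_lt_trans _ gN)// g_homo.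
Qed.

(** Permuting the arguments of [T] decides which coefficients are paid: with
    [x] in first position the bound costs [a], with [x] in the last two it
    costs [b + c].  This split makes the constant less than 1 as soon as
    [a + b + c < 1]. *)
Lemma Gmetric_contract_fixpoint (R : realType) (X : Type)
    (G : X -> X -> X -> R) (T : X -> X) (u : X) (a b c : R) :
  is_Gmetric G -> T u = u -> 0 <= a -> 0 <= b -> 0 <= c -> a + b + c < 1 ->
  (forall x y z : X, G (T x) (T y) (T z) <=
     a * G x (T x) (T x) + b * G y (T y) (T y) + c * G z (T z) (T z)) ->
  forall x, G (T x) u u <= a / (1 - (b + c)) * G x u u.
Proof.
move=> GX fix_u a0 b0 c0 abc1 contractT x.
have Guuu : G u u u = 0 by exact: (Gmetric_eq0 GX).
have Txuu := contractT x u u; have uTxTx := contractT u x x.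
have D_le := Gmetric_rectangle GX x (T x) (T x) u.
rewrite !fix_u Guuu in Txuu uTxTx.
have k0 : 0 < 1 - (b + c) by lra.
rewrite mulrAC ler_pdivlMr//.
set D := G x (T x) (T x) in Txuu uTxTx D_le.
have {uTxTx} : D * (1 - (b + c)) <= G x u u by lra.
move=> /(ler_wpM2l a0); apply: le_trans.
by rewrite mulrA ler_wpM2r ?(ltW k0)//; lra.
Qed.

(** Convergence of the single sequence [G (x_ n) u u] controls the double
    limit, by routing the rectangle inequality through [u]. *)
Lemma Gcvg_of_cvg0 (R : realType) (X : Type) (G : X -> X -> X -> R)
    (x_ : nat -> X) (u : X) :
  is_Gmetric G -> G (x_ n) u u @[n --> \oo] --> (0 : R) -> Gcvg G x_ u.
Proof.
move=> GX gcvg.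
have gcvg1 : G (x_ nm.1) u u @[nm --> (\oo, \oo)] --> (0 : R).
  exact: (cvg_comp _ _ cvg_fst gcvg).
have gcvg2 : G (x_ nm.2) u u @[nm --> (\oo, \oo)] --> (0 : R).
  exact: (cvg_comp _ _ cvg_snd gcvg).
have gcvg12 : G (x_ nm.1) u u + G (x_ nm.2) u u @[nm --> (\oo, \oo)]
    --> (0 : R).
  by rewrite -[X in _ --> X]addr0; exact: cvgD gcvg1 gcvg2.
apply: squeeze_cvgr (cvg_cst 0) gcvg12.
apply: nearW => -[n m] /=; rewrite (Gmetric_ge0 GX)/=.
have := Gmetric_rectangle GX (x_ n) u (x_ m) u.
have [_ -> _ _ _] := Gmetric_sym GX u (x_ n) (x_ m).
by have [_ _ _ -> _] := Gmetric_sym GX u u (x_ m).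
Qed.

Theorem theorem2p4 (R : realType) (X : Type) (G : X -> X -> X -> R)
    (W : X -> X -> {i01 R} -> {i01 R} -> X)
    (convexGW : is_convex_Gmetric G W)
    (T : X -> X) (u : X) (fix_u : T u = u)
    (a b c : R) (a_ge0 : 0 <= a) (b_ge0 : 0 <= b) (c_ge0 : 0 <= c)
    (abc_ge0 : 0 <= a + b + c) (abc_lt1 : a + b + c < 1) (a_lt : a < 1 / 2)
    (contractT : forall x y z : X,
      G (T x) (T y) (T z) <=
        a * G x (T x) (T x) + b * G y (T y) (T y) + c * G z (T z) (T z))
    (x0 : X) (alpha : nat -> {i01 R})
    (alpha_sum : (\sum_(0 <= n <oo) ((alpha n)%:num : R)%:E = +oo)%E)
    (x_ : nat -> X) (x_0 : x_ 0%N = x0)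
    (mann : is_Mann_iteration W T alpha x_) :
  exists p : X, T p = p /\ Gcvg G x_ p.
Proof.
have [GX convexW] := convexGW.
exists u; split => //.
apply: Gcvg_of_cvg0 => //.
have k1 : 0 < 1 - a / (1 - (b + c)).
  by rewrite subr_gt0 ltr_pdivrMr; lra.
apply: (Mann_decay_cvg0 _ _ _ _ k1 _ _ alpha_sum) => n; first by [].
  exact: (Gmetric_ge0 GX).
rewrite mann.
apply: le_trans (convexW _ _ _ _ _ _ _) _; first by rewrite /= subrK.
have /(ler_wpM2l (ge0 (alpha n))) :=
  Gmetric_contract_fixpoint _ _ _ _ _ _ _ _ GX fix_u a_ge0 b_ge0 c_ge0 abc_lt1
    contractT (x_ n).
rewrite /=; lra.
Qed.
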